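(* Let $n,B_1,B_2\in\mathbb{N}$ with $n\ge B_1+B_2\ge 2B_1$, let $k\ge3$ be odd with $k$ dividing $B_2$, and let $f_j=1/j$ for $j\in[n]$. Let $h_1,\dots,h_k:[n]\setminus[B_1]\to[B_2/k]$ and $s_1,\dots,s_k:[n]\setminus[B_1]\to\{-1,1\}$ be independent, truly (uniformly) random hash functions. For $i\in[n]\setminus[B_1]$ define $$\tilde f_i=\operatorname{median}_{\ell\in[k]}\Big(s_\ell(i)\sum_{j\in[n]\setminus[B_1]}[h_\ell(j)=h_\ell(i)]\,s_\ell(j)\,f_j\Big).$$ Then for every $i\in[n]\setminus[B_1]$, $\mathbb{E}[|\tilde f_i-f_i|]=\Omega(1/B_2)$, with an absolute implied constant.
   Context: $[m]=\{1,\dots,m\}$, $[E]$ is the indicator of event $E$, and the median of an odd number of reals is the middle value. This models learned Count-Sketch with $k$ rows and $B_2$ total buckets for the non-heavy items. *)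

(* Defs.v *)
From mathcomp Require Import all_boot all_order all_algebra.
From mathcomp Require Import all_classical all_reals all_analysis.

Set Implicit Arguments.
Unset Strict Implicit.
Unset Printing Implicit Defensive.

Import Order.TTheory GRing.Theory Num.Theory.

Local Open Scope classical_set_scope.
Local Open Scope ring_scope.

(* Mutual independence of a finite family of classes of events: the product
   rule for every subfamily. *)
Definition mutually_independent (d : measure_display) (T : measurableType d)
    (R : realType) (P : probability T R) (I : finType)
    (F : I -> set (set T)) : Prop :=
  forall (J : {set I}) (E : I -> set T), (forall i, i \in J -> F i (E i)) ->
    P (\bigcap_(i in [set i | i \in J]) E i) = (\prod_(i in J) P (E i))%E.

(* The events determined by X, the finite type V carrying the discrete
   sigma-algebra. *)
Definition events_of (T : Type) (V : finType) (X : T -> V) : set (set T) :=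
  preimage_set_system setT X setT.

Definition uniform_rv (d : measure_display) (T : measurableType d)
    (R : realType) (P : probability T R) (V : finType) (X : T -> V) : Prop :=
  events_of X `<=` measurable /\
  forall v : V, P (X @^-1` [set v]) = ((#|V|%:R)^-1)%:E.

(* The set [n] \ [B1] = {B1 + 1, ..., n}, with 1-based items. *)
Definition item (n B1 : nat) : finType := {j : 'I_n.+1 | (B1 < j)%N}.

Definition freq (R : realType) (n B1 : nat) (j : item n B1) : R :=
  (nat_of_ord (val j))%:R^-1.

Definition bucket_hash (n B1 b : nat) : finType := {ffun item n B1 -> 'I_b}.

(* A sign is a boolean e, standing for (-1) ^+ e. *)
Definition sign_hash (n B1 : nat) : finType := {ffun item n B1 -> bool}.

Definition independent_random_hashes (d : measure_display)
    (T : measurableType d) (R : realType) (P : probability T R)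
    (n B1 b k : nat) (h : 'I_k -> T -> bucket_hash n B1 b)
    (s : 'I_k -> T -> sign_hash n B1) : Prop :=
  [/\ forall l, uniform_rv P (h l),
      forall l, uniform_rv P (s l) &
      mutually_independent P (fun x : 'I_k + 'I_k =>
        match x with inl l => events_of (h l) | inr l => events_of (s l) end)].

(* The middle value of a sequence of odd size. *)
Definition median (R : realType) (r : seq R) : R :=
  nth 0 (sort <=%R r) (size r)./2.

Definition row_estimate (R : realType) (n B1 b : nat) (g : bucket_hash n B1 b)
    (t : sign_hash n B1) (i : item n B1) : R :=
  (-1) ^+ t i * \sum_(j : item n B1) (g j == g i)%:R * (-1) ^+ t j * freq R j.

Definition cs_estimate (R : realType) (n B1 b k : nat)
    (g : 'I_k -> bucket_hash n B1 b) (t : 'I_k -> sign_hash n B1)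
    (i : item n B1) : R :=
  median [seq row_estimate R (g l) (t l) i | l <- enum 'I_k].

(* Main.v *)
Require Import Defs.
From mathcomp Require Import all_boot all_order all_algebra.
From mathcomp Require Import all_classical all_reals all_analysis.
From mathcomp Require Import perm measurable_realfun zify ring lra.
Import Order.TTheory GRing.Theory Num.Theory.
Local Open Scope ring_scope.

(* Put t = 1 / (2 B2), let X_l be the error of row l and q = P(|X_l| < t).
   Given the buckets, X_l is up to sign a random signed sum in which every
   colliding item among B1 + 1, ..., B1 + B2 has weight at least t, so by
   Erdos' form of the Littlewood-Offord bound the conditional probability of
   |X_l| < t is at most (m + 1)^(-1/2), m being the number of these items.
   Since m + 1 is the size of the bucket of i, the mean of 1 / (m + 1) is at
   most (number of buckets) / B2 = 1 / k, whence q^2 <= 1 / k.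
   By symmetry p = P(X_l >= t) = (1 - q) / 2, and comparing the binomial tail
   with that of a fair coin by Cauchy-Schwarz, more than half of the rows have
   X_l >= t with probability at least (4 p (1 - p))^k / 4
   = (1 - q^2)^k / 4 >= (1 - 1/k)^k / 4 >= 1 / 24. In that event the median
   error is at least t. *)

(** * Walk counts and central binomial coefficients *)

(** The number of sign sequences of length [m] with sum [x]; integer positions keep the recurrence
    free of boundary cases. *)
Fixpoint walks (m : nat) (x : int) : nat :=
  if m is m'.+1 then (walks m' (x - 1) + walks m' (x + 1))%N else (x == 0).

(* Walks ending in (-r, r]: this is the sum of the r largest binomial
   coefficients 'C(m, _), the extremal value in the Littlewood-Offord bound. *)
Definition central_walks (m r : nat) : nat :=
  (\sum_(i < r.*2) walks m (i%:Z - r%:Z + 1))%N.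

Lemma central_walks0 (r : nat) : (0 < r)%N -> (0 < central_walks 0 r)%N.
Proof.
case: r => // r _; rewrite /central_walks.
have lt_r : (r < r.+1.*2)%N by lia.
rewrite (bigD1 (Ordinal lt_r)) //=.
suff -> : r%:Z - r.+1%:Z + 1 == 0 by [].
by apply/eqP; lia.
Qed.

(** Shifting (-r-1, r+1] by -1 and by +1 gives (-r-2, r] and (-r, r+2], which cover (-r-2, r+2] once
    and (-r, r] a second time. The regrouping of windows in [littlewood_offord] mirrors this. *)
Lemma central_walksS (m r : nat) :
  central_walks m.+1 r.+1 = (central_walks m r.+2 + central_walks m r)%N.
Proof.
rewrite /central_walks /= big_split /=.
(* In terms of [f] all four sums start at index 0 or 2, so only their last terms differ. *)
pose f (i : nat) := walks m (i%:Z - r.+1%:Z).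
rewrite (eq_bigr (fun i : 'I_r.+1.*2 => f i)); last first.
  by move=> i _; rewrite /f; congr walks; lia.
rewrite [X in (_ + X)%N = _](eq_bigr (fun i : 'I_r.+1.*2 => f i.+2)); last first.
  by move=> i _; rewrite /f; congr walks; lia.
rewrite [X in _ = (X + _)%N](eq_bigr (fun i : 'I_r.+2.*2 => f i)); last first.
  by move=> i _; rewrite /f; congr walks; lia.
rewrite [X in _ = (_ + X)%N](eq_bigr (fun i : 'I_r.*2 => f i.+2)); last first.
  by move=> i _; rewrite /f; congr walks; lia.
rewrite !doubleS !(big_ord_recr r.*2.+3) !(big_ord_recr r.*2.+2) /=.
rewrite [X in (_ + X)%N = _](big_ord_recr r.*2.+1) /=.
rewrite [X in (_ + (X + _))%N = _](big_ord_recr r.*2) /=.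
lia.
Qed.

Lemma walks_lt (m : nat) (x : int) : x < - m%:Z -> walks m x = 0%N.
Proof.
elim: m x => [|m IH] x lt_x /=; first by case: eqP => //; lia.
by rewrite !IH //; lia.
Qed.

Lemma walks_parity (m : nat) (j : int) : walks m (2 * j - m%:Z + 1) = 0%N.
Proof.
elim: m j => [|m IH] j /=; first by case: eqP => //; lia.
have -> : 2 * j - m.+1%:Z + 1 - 1 = 2 * (j - 1) - m%:Z + 1 by lia.
have -> : 2 * j - m.+1%:Z + 1 + 1 = 2 * j - m%:Z + 1 by lia.
by rewrite !IH.
Qed.

(** With j steps up and m - j steps down the endpoint is 2j - m. *)
Lemma walksE (m j : nat) : walks m (2 * j%:Z - m%:Z) = 'C(m, j).
Proof.
elim: m j => [|m IH] [|j] /=.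
- by [].
- by rewrite bin0n; case: eqP => //; lia.
- rewrite bin0 walks_lt; last by lia.
  by have -> : 2 * 0%:Z - m.+1%:Z + 1 = 2 * 0%:Z - m%:Z; [lia|rewrite IH bin0].
- have -> : 2 * j.+1%:Z - m.+1%:Z - 1 = 2 * j%:Z - m%:Z by lia.
  have -> : 2 * j.+1%:Z - m.+1%:Z + 1 = 2 * j.+1%:Z - m%:Z by lia.
  by rewrite !IH binS addnC.
Qed.

(** Of the two points 0 and 1 of (-1, 1], only the one with the parity of [m] is reachable. *)
Lemma central_walks1 (m : nat) : central_walks m 1 = 'C(m, uphalf m).
Proof.
rewrite /central_walks (_ : 1.*2 = 2) // big_ord_recr big_ord1 /=.
have [m_odd|m_even] := boolP (odd m).
  have -> : 0 - 1%:Z + 1 = 2 * ((m.-1)./2)%:Z - m%:Z + 1 by lia.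
  rewrite walks_parity.
  by have -> : 1%:Z - 1%:Z + 1 = 2 * (uphalf m)%:Z - m%:Z; [lia|rewrite walksE].
have -> : 1%:Z - 1%:Z + 1 = 2 * (m./2)%:Z - m%:Z + 1 by lia.
rewrite walks_parity addn0.
by have -> : 0 - 1%:Z + 1 = 2 * (uphalf m)%:Z - m%:Z; [lia|rewrite walksE].
Qed.

Lemma bin_double_S (l : nat) :
  (l.+1 * 'C(l.+1.*2, l.+1) = 2 * l.*2.+1 * 'C(l.*2, l))%N.
Proof.
have e1 := mul_bin_diag l.*2.+1 l.
have e2 : 'C(l.*2.+1, l.+1) = 'C(l.*2.+1, l).
  by rewrite -bin_sub; [congr binomial; lia|lia].
rewrite doubleS binS -e2 addnn -mul2n mulnCA -[(2 * _ * _)%N]mulnA.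
by rewrite -e1.
Qed.

(** The induction step multiplies the left side by 4(2l+1)(2l+3)/(l+1)^2, at most 16 because
    (2l+1)(2l+3) = 4(l+1)^2 - 1. *)
Lemma central_bin_bound (l : nat) :
  (l.*2.+1 * 'C(l.*2, l) ^ 2 <= 16 ^ l)%N.
Proof.
elim: l => [//|l IH].
rewrite -(@leq_pmul2l (l.+1 ^ 2)) ?expn_gt0 //.
have -> : (l.+1 ^ 2 * (l.+1.*2.+1 * 'C(l.+1.*2, l.+1) ^ 2) =
           l.+1.*2.+1 * (l.+1 * 'C(l.+1.*2, l.+1)) ^ 2)%N by rewrite !expnMn; ring.
rewrite bin_double_S (expnS 16 l).
have : (l.*2.+1 * l.+1.*2.+1 <= 4 * l.+1 ^ 2)%N by nia.
move: IH; set c := 'C(_, _); set e := (16 ^ l)%N; move=> IH le_l.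
have -> : (l.+1.*2.+1 * (2 * l.*2.+1 * c) ^ 2 =
           4 * ((l.*2.+1 * c ^ 2) * (l.*2.+1 * l.+1.*2.+1)))%N.
  by rewrite !expnMn; ring.
have -> : (l.+1 ^ 2 * (16 * e) = 4 * (e * (4 * l.+1 ^ 2)))%N by ring.
by rewrite leq_mul2l /= leq_mul.
Qed.

(** For m = 2l+1 the identity C(2l+2, l+1) = 2 C(2l+1, l+1) reduces the claim to the even case. *)
Lemma bin_uphalf_bound (m : nat) : (m.+1 * 'C(m, uphalf m) ^ 2 <= 4 ^ m)%N.
Proof.
have [m_odd|m_even] := boolP (odd m); last first.
  have -> : uphalf m = m./2 by lia.
  have e : m = m./2.*2 by lia.
  rewrite {1 2 4}e; have := central_bin_bound m./2.
  by rewrite -[16%N]/(4 ^ 2)%N -expnM mul2n.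
have [l ->] : exists l, m = l.*2.+1 by exists m./2; lia.
have -> : uphalf l.*2.+1 = l.+1 by lia.
have := central_bin_bound l.+1.
have -> : ('C(l.+1.*2, l.+1) = 2 * 'C(l.*2.+1, l.+1))%N.
  rewrite doubleS binS -(@bin_sub l.*2.+1 l) ?mul2n -?addnn; last by lia.
  by congr (_ + 'C(_, _))%N; lia.
rewrite -[16%N]/(4 ^ 2)%N -expnM (mul2n l.+1) doubleS (expnS 4 l.*2.+1).
set c := 'C(_, _); set e := (4 ^ _)%N; nia.
Qed.

(** * The Littlewood-Offord small ball bound *)

Definition flip (T : finType) (j : T) (s : {ffun T -> bool}) : {ffun T -> bool} :=
  [ffun x => if x == j then ~~ s x else s x].

Lemma flipK (T : finType) (j : T) : involutive (flip T j).
Proof.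
by move=> s; apply/ffunP => x; rewrite !ffunE; case: eqP => // _; rewrite negbK.
Qed.

Definition signed_sum (R : realType) (T : finType) (c : T -> R) (r : seq T)
    (s : {ffun T -> bool}) : R := \sum_(j <- r) (-1) ^+ s j * c j.

(** [xs] lists left endpoints, from the top down in separated families. Half-open windows may touch
    without sharing a point. *)
Definition windows (R : realType) (t : R) (xs : seq R) (y : R) : nat :=
  count (fun x => x <= y < x + 2 * t) xs.

Lemma windows_shift (R : realType) (t : R) (xs : seq R) (a y : R) :
  windows R t xs (a + y) = windows R t [seq x - a | x <- xs] y.
Proof.
rewrite /windows count_map; apply: eq_count => x /=.
by congr (_ && _); apply/idP/idP; lra.
Qed.

Lemma windows_le1 (R : realType) (t : R) (xs : seq R) (y : R) :
  pairwise (fun x z => z + 2 * t <= x) xs ->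
  (windows R t xs y <= (0 < size xs))%N.
Proof.
rewrite /windows; elim: xs => //= x xs IH /andP[/allP x_xs /IH {}IH].
have [in_x|_] := boolP (x <= y < x + 2 * t).
  rewrite (_ : count _ _ = 0%N) //; apply/eqP; rewrite -leqn0 leqNgt -has_count.
  by apply/hasPn => z /x_xs; lra.
by apply: (leq_trans IH); case: (size xs).
Qed.

(* Flipping the sign of j pairs up the sign patterns. *)
Lemma sum_signed_sum_cons (R : realType) (T : finType) (c : T -> R) (j : T)
    (r : seq T) (F : R -> nat) : j \notin r ->
  (2 * \sum_s F (signed_sum R T c (j :: r) s) =
   \sum_s F (c j + signed_sum R T c r s)%R +
   \sum_s F (- c j + signed_sum R T c r s)%R)%N.
Proof.
move=> jr; rewrite mul2n -addnn.
rewrite [X in (_ + X)%N = _](reindex_inj (inv_inj (flipK T j))) /=.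
rewrite -!big_split /=; apply: eq_bigr => s _.
have e : signed_sum R T c r (flip T j s) = signed_sum R T c r s.
  rewrite /signed_sum !big_seq; apply: eq_bigr => x xr.
  by rewrite ffunE; case: eqP => // xj; rewrite -xj xr in jr.
rewrite /signed_sum !big_cons -!/(signed_sum R T c r _) e ffunE eqxx.
by case: (s j); rewrite /= ?expr0 ?expr1 ?mul1r ?mulN1r // addnC.
Qed.

(* Erdos' Littlewood-Offord bound, for a union of windows. When the step of j
   is at least t, the topmost window shifted upwards lies above all the windows
   shifted downwards, so the two shifted families can be regrouped into
   separated families with one window more and one window fewer. *)
Lemma littlewood_offord (R : realType) (T : finType) (c : T -> R) (t : R)
    (r : seq T) (xs : seq R) : 0 <= t -> uniq r ->
  pairwise (fun x z => z + 2 * t <= x) xs ->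
  (2 ^ count (fun j => t <= c j)%R r *
     \sum_s windows R t xs (signed_sum R T c r s) <=
   2 ^ #|T| * central_walks (count (fun j => t <= c j)%R r) (size xs))%N.
Proof.
move=> t0; elim: r xs => [|j r IH] xs /=.
  move=> _ xs_sep; rewrite mul1n.
  apply: (@leq_trans (\sum_(s : {ffun T -> bool}) (0 < size xs))%N).
    by apply: leq_sum => s _; exact: windows_le1.
  rewrite sum_nat_const card_ffun card_bool leq_mul2l; apply/orP; right.
  by case: (posnP (size xs)) => // /central_walks0.
move=> /andP[jr /IH {}IH] xs_sep.
have sep_map a (ys : seq R) : pairwise (fun x z => z + 2 * t <= x) ys ->
    pairwise (fun x z => z + 2 * t <= x) [seq x - a | x <- ys].
  by rewrite pairwise_map; apply: sub_pairwise => x y /=; lra.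
rewrite -(@leq_pmul2l 2) // mulnCA sum_signed_sum_cons //.
under eq_bigr do rewrite windows_shift.
under [X in (_ * (_ + X) <= _)%N]eq_bigr do rewrite windows_shift.
case: (boolP (t <= c j)) => [tc|_] /=; last first.
  (* A weight below [t] leaves the count unchanged: both shifted families stay separated and are
     bounded one by one. *)
  rewrite add0n mulnDr mul2n -addnn leq_add //.
    by apply: (leq_trans (IH _ (sep_map _ _ xs_sep))); rewrite size_map.
  by apply: (leq_trans (IH _ (sep_map _ _ xs_sep))); rewrite size_map.
case: xs xs_sep => [|x xs] xs_sep.
  by rewrite /= !big1 ?muln0 // => s _.
have sep_xs : pairwise (fun x z => z + 2 * t <= x) xs.
  by move: xs_sep => /= /andP[].
pose up := (x + c j) :: [seq z - c j | z <- x :: xs].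
pose dn := [seq z - - c j | z <- xs].
have sep_up : pairwise (fun x z => z + 2 * t <= x) up.
  rewrite /up pairwise_cons sep_map // andbT.
  (* The new top window clears the old one because x - c j + 2t <= x + c j, which is where t <= c j
     enters. *)
  apply/allP => z /mapP[w + ->]; rewrite inE => /predU1P[->|]; first by lra.
  by move: xs_sep => /= /andP[/allP h _] /h; lra.
have sep_dn : pairwise (fun x z => z + 2 * t <= x) dn by exact: sep_map.
pose E ys := (\sum_(s : {ffun T -> bool}) windows R t ys (signed_sum R T c r s))%N.
have regroup : (E [seq z - c j | z <- x :: xs]%R + E [seq z - - c j | z <- x :: xs]%R =
                E up + E dn)%N.
  rewrite -!big_split /=; apply: eq_bigr => s _.
  by rewrite /windows /up /dn /= opprK addnCA addnA addnA.
rewrite -/(E _) -/(E _) [(E _ + E _)%N]regroup add1n expnS -mulnA leq_pmul2l //.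
rewrite mulnDr [size _]/= central_walksS mulnDr leq_add //.
  by apply: (leq_trans (IH _ sep_up)); rewrite /up /= size_map.
by apply: (leq_trans (IH _ sep_dn)); rewrite /dn size_map.
Qed.

(** The ball lies in the single window [-t, t), so the central binomial bound applies. Squaring
    avoids square roots. *)
Lemma small_ball (R : realType) (T : finType) (c : T -> R) (t : R) (M : {set T}) :
  0 <= t -> (forall j, j \in M -> t <= c j) ->
  #|M|.+1%:R *
    (#|[set s : {ffun T -> bool} | `|\sum_j (-1) ^+ s j * c j| < t]|%:R /
       (2 ^ #|T|)%:R) ^+ 2 <= 1 :> R.
Proof.
move=> t0 Mc.
set N := #|[set s | _]|.
pose m := count (fun j => t <= c j) (index_enum T).
have Mm : (#|M| <= m)%N.
  rewrite /m -sum1_count -sum1_card big_mkcond [X in (_ <= X)%N]big_mkcond.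
  by apply: leq_sum => j _; case: ifP => // /Mc ->.
have := littlewood_offord R T c t (index_enum T) [:: - t] t0 (index_enum_uniq T) isT.
rewrite -/m /= central_walks1.
set Z := (\sum_s _)%N => le_Z.
have NZ : (N <= Z)%N.
  rewrite /N /Z -sum1_card big_mkcond /=; apply: leq_sum => s _.
  rewrite inE /windows /signed_sum /= addn0.
  by case: ifPn => //; rewrite ltr_norml => small; rewrite (_ : _ && _ = true) //; lra.
have key : (m.+1 * N ^ 2 <= (2 ^ #|T|) ^ 2)%N.
  rewrite -(@leq_pmul2l ((2 ^ m) ^ 2)) ?expn_gt0 //.
  have -> : ((2 ^ m) ^ 2 * (m.+1 * N ^ 2) = m.+1 * (2 ^ m * N) ^ 2)%N.
    by rewrite !expnMn; ring.
  apply: (@leq_trans (m.+1 * (2 ^ #|T| * 'C(m, uphalf m)) ^ 2)).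
    rewrite leq_mul2l /= leq_sqr; apply: leq_trans le_Z.
    by rewrite leq_mul2l NZ orbT.
  have := bin_uphalf_bound m.
  rewrite (_ : (4 ^ m = (2 ^ m) ^ 2)%N); last by rewrite -expnM mulnC expnM.
  move=> h; rewrite expnMn mulnCA [X in (_ <= X)%N]mulnC leq_mul2l.
  by rewrite h orbT.
rewrite expr_div_n mulrA ler_pdivrMr ?exprn_gt0 ?ltr0n ?expn_gt0 // mul1r.
rewrite -!natrX -natrM ler_nat.
by apply: leq_trans key; rewrite leq_mul2r ltnS Mm orbT.
Qed.

(** * The average inverse size of a bucket *)

(* For a fixed g the sum over j in A of the inverse size of the bucket of j
   counts the nonempty buckets, and all j in A contribute equally on average. *)
Lemma sum_inv_bucket (R : realType) (T V : finType) (A : {set T}) (i : T) :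
  i \in A ->
  #|A|%:R * \sum_(g : {ffun T -> V}) (#|[set j in A | g j == g i]|%:R^-1) <=
    #|V|%:R * #|{ffun T -> V}|%:R :> R.
Proof.
move=> iA.
pose W (g : {ffun T -> V}) x : R := #|[set j in A | g j == g x]|%:R^-1.
have sym x : x \in A -> \sum_g W g i = \sum_g W g x.
  move=> xA.
  (* Exchanging the hash values of [i] and [x] permutes the functions [g] and carries the bucket of
     [x] to that of [i]. *)
  pose sw (g : {ffun T -> V}) := [ffun y => g (tperm i x y)] : {ffun T -> V}.
  have swK : involutive sw.
    by move=> g; apply/ffunP => y; rewrite !ffunE tpermK.
  rewrite (reindex_inj (inv_inj swK)); apply: eq_bigr => g _.
  rewrite /W; congr (_%:R^-1).
  rewrite -(card_imset _ (@perm_inj _ (tperm i x))); apply: eq_card => y.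
  rewrite -{1}(tpermK i x y) (mem_imset _ _ (@perm_inj _ (tperm i x))) !inE !ffunE tpermL tpermK.
  congr (_ && _).
  by case: tpermP => [->|->|]; rewrite ?iA ?xA.
rewrite -[#|A|]sum1_card natr_sum mulr_suml.
under eq_bigr => x xA do rewrite mul1r (sym x xA).
rewrite exchange_big /= -[#|{ffun _}|]sum1_card natr_sum mulr_sumr.
apply: ler_sum => g _; rewrite mulr1.
rewrite (partition_big g predT) //=.
rewrite -[#|V|]sum1_card natr_sum; apply: ler_sum => v _.
pose S := [set j in A | g j == v].
have -> : \sum_(x in A | g x == v) W g x = \sum_(x in S) #|S|%:R^-1.
  by apply: eq_big => [x|x /andP[_ /eqP gx]]; rewrite ?inE // /W gx.
rewrite sumr_const -[X in X <= _]mulr_natr.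
(* A nonempty bucket contributes 1, an empty one 0. *)
have [->|S0] := eqVneq #|S|%:R (0 : R); first by rewrite mulr0.
by rewrite mulVf.
Qed.

(** * Majorities among independent rows, binomial tails and the median *)

(** For odd [k] exactly one of a set and its complement is a majority. *)
Lemma card_majority (k : nat) : odd k ->
  (2 * \sum_(J : {set 'I_k} | k./2 < #|J|) 1 = 2 ^ k)%N.
Proof.
move=> k_odd; rewrite mul2n -addnn big_mkcond /=.
rewrite [X in (_ + X)%N](reindex_inj (inv_inj (@finset.setCK 'I_k))) /=.
rewrite -big_split /= (eq_bigr (fun=> 1%N)).
  by rewrite sum1_card -cardsT -powersetT card_powerset cardsT card_ord.
move=> J _; have := cardsC J; rewrite card_ord.
move: #|J| #|~: J| k_odd => a b k_odd; case: ifP; case: ifP; lia.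
Qed.

Lemma card_pattern (T : finType) (k : nat) (H : {set T}) (J : {set 'I_k}) :
  #|[set v : {ffun 'I_k -> T} | [set l | v l \in H] == J]| =
  (#|H| ^ #|J| * (#|T| - #|H|) ^ (k - #|J|))%N.
Proof.
pose F (l : 'I_k) : {pred T} := [pred x | (x \in H) == (l \in J)].
rewrite (_ : #|_| = #|family F|); last first.
  apply: eq_card => v; rewrite inE; apply/eqP/familyP => [vJ l|fv].
    by rewrite inE -vJ inE.
  by apply/finset.setP => l; rewrite inE; have := fv l; rewrite inE => /eqP.
rewrite card_family foldrE big_map big_enum /= (bigID (mem J)) /=.
rewrite (eq_bigr (fun=> #|H|)); last first.
  by move=> l lJ; apply: eq_card => x; rewrite inE lJ eqb_id.
rewrite prod_nat_const; congr (_ * _)%N.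
rewrite (eq_bigr (fun=> (#|T| - #|H|)%N)); last first.
  move=> l /negbTE lJ; rewrite -(cardsC H) addKn; apply: eq_card => x.
  by rewrite !inE lJ eqbF_neg.
rewrite prod_nat_const; congr (_ ^ _)%N.
have <- : #|~: J| = (k - #|J|)%N.
  by rewrite -(addKn #|J| #|~: J|) cardsC card_ord.
by apply: eq_card => l; rewrite !inE.
Qed.

Lemma prod_if_mem (R : comPzRingType) (k : nat) (J : {set 'I_k}) (a b : R) :
  \prod_(l < k) (if l \in J then a else b) = a ^+ #|J| * b ^+ (k - #|J|).
Proof.
rewrite (bigID (mem J)) /=; congr (_ * _).
  by rewrite (eq_bigr (fun=> a)) ?prodr_const // => l ->.
rewrite (eq_bigr (fun=> b)) => [|l /negbTE -> //].
have <- : #|~: J| = (k - #|J|)%N.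
  by rewrite -(addKn #|J| #|~: J|) cardsC card_ord.
by rewrite prodr_const; congr (_ ^+ _); apply: eq_card => l; rewrite !inE.
Qed.

(* Bounding each term of the binomial tail below by x >= 2 mu - mu^2 / x
   amounts to Cauchy-Schwarz against the tail of a fair coin. *)
Lemma binomial_tail (R : realType) (k : nat) (p : R) : odd k -> 0 < p -> p < 1 ->
  (4 * (p * (1 - p))) ^+ k / 4 <=
  \sum_(J : {set 'I_k} | (k./2 < #|J|)%N) p ^+ #|J| * (1 - p) ^+ (k - #|J|).
Proof.
move=> k_odd p0 p1.
have q0 : 0 < 1 - p by rewrite subr_gt0.
pose x (J : {set 'I_k}) := p ^+ #|J| * (1 - p) ^+ (k - #|J|).
have x0 J : 0 < x J by rewrite /x mulr_gt0 ?exprn_gt0.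
(* The number 2^(k-1) of majorities divided by the sum of all 1 / x J: the value that maximises the
   final lower bound. *)
pose mu := 2 ^+ k / 2 * (p * (1 - p)) ^+ k.
(* The inverses factor into 1/p + 1/(1-p) for each row. *)
have sumV : \sum_J (x J)^-1 = ((p * (1 - p)) ^+ k)^-1.
  have -> : ((p * (1 - p)) ^+ k)^-1 = ((1 - p)^-1 + p^-1) ^+ k.
    rewrite -exprVn; congr (_ ^+ _); field.
    by rewrite (gt_eqF p0) (gt_eqF q0).
  rewrite addrC -[k in RHS]card_ord -prodr_const bigA_distr.
  by apply: eq_bigr => J _; rewrite prod_if_mem !exprVn -invfM.
pose A : R := 2 ^+ k / 2.
have cardA : \sum_(J : {set 'I_k} | (k./2 < #|J|)%N) 1 = A.
  apply: (@mulfI _ 2%:R); first by rewrite pnatr_eq0.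
  rewrite /A [RHS]mulrC divfK ?pnatr_eq0 // -natrX -(card_majority k k_odd).
  by rewrite natrM natr_sum.
have amgm J : 2 * mu - mu ^+ 2 * (x J)^-1 <= x J.
  rewrite -subr_ge0.
  have -> : x J - (2 * mu - mu ^+ 2 / x J) = (x J - mu) ^+ 2 / x J.
    by field; rewrite gt_eqF.
  by rewrite divr_ge0 ?sqr_ge0 // ltW.
apply: (@le_trans _ _ (\sum_(J : {set 'I_k} | (k./2 < #|J|)%N)
   (2 * mu * 1 - mu ^+ 2 * (x J)^-1))); last first.
  by apply: ler_sum => J _; rewrite mulr1; exact: amgm.
rewrite sumrB -!mulr_sumr cardA.
(* Extending the sum of inverses to all [J] only lowers the bound and gives it a closed form. *)
apply: (@le_trans _ _ (2 * mu * A - mu ^+ 2 * \sum_J (x J)^-1)); last first.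
  rewrite lerD2l lerN2 ler_wpM2l ?sqr_ge0 //.
  rewrite [leRHS](bigID (fun J : {set 'I_k} => (k./2 < #|J|)%N)) /= lerDl.
  by apply: sumr_ge0 => J _; rewrite invr_ge0 ltW.
rewrite sumV /mu -/A.
have D0 : (p * (1 - p)) ^+ k != 0 by rewrite gt_eqF // exprn_gt0 // mulr_gt0.
rewrite exprMn (_ : 4 ^+ k = 4 * A ^+ 2); last first.
  by rewrite /A expr_div_n -exprM mulnC exprM -(natrX _ 2 2) [RHS]mulrC divfK ?pnatr_eq0.
move: D0; set D := (p * (1 - p)) ^+ k => D0.
rewrite le_eqVlt; apply/orP; left; apply/eqP; field.
exact: D0.
Qed.

(** Bernoulli's inequality at exponent k would give only 0. With k = 2m+1 and u = 1/k it is used at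
    exponent m: (1-u)^m >= (1+u)/2 >= 1/2, whence (1-u)^k >= (2/3)(1/4). *)
Lemma bernoulli_sixth (R : realType) (k : nat) : (3 <= k)%N -> odd k ->
  1 / 6 <= (1 - k%:R^-1) ^+ k :> R.
Proof.
move=> k3 k_odd; set u : R := k%:R^-1.
have u0 : 0 < u by rewrite invr_gt0 ltr0n; lia.
have ku : k%:R * u = 1 by rewrite divff // pnatr_eq0; lia.
have u3 : 3 * u <= 1 by rewrite -[leRHS]ku ler_wpM2r ?(ltW u0) // (ler_nat _ 3).
have bern m : (m <= k)%N -> 1 - m%:R * u <= (1 - u) ^+ m.
  elim: m => [|m IH] mk; first by rewrite mul0r subr0 expr0.
  have := IH (ltnW mk); rewrite exprS -natr1 => h.
  have : (1 - u) * (1 - m%:R * u) <= (1 - u) * (1 - u) ^+ m.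
    by rewrite ler_wpM2l //; lra.
  have : 0 <= m%:R * u * u by rewrite !mulr_ge0 ?ler0n ?(ltW u0).
  lra.
have [m km] : exists m, k = m.*2.+1 by exists k./2; lia.
have := bern m; rewrite {1}km => /(_ ltac:(lia)).
have : 2 * (m%:R * u) + u = 1.
  by rewrite -[RHS]ku {1}km -[in RHS]natr1 -mul2n natrM; ring.
have -> : (1 - u) ^+ k = (1 - u) * ((1 - u) ^+ m) ^+ 2.
  by rewrite {1}km exprS -exprM muln2.
move: ((1 - u) ^+ m) (m%:R * u) => y z zu zy.
have : 1 / 2 <= y by lra.
nra.
Qed.

(** Tuples are grouped by the set of rows falling in [H]; each group has the binomial weight of that
    set, so [binomial_tail] applies. *)
Lemma majority_count (R : realType) (T : finType) (k : nat) (H : {set T}) (p : R) :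
  odd k -> 0 < p -> p < 1 -> #|H|%:R = p * #|T|%:R ->
  (4 * (p * (1 - p))) ^+ k / 4 * #|{ffun 'I_k -> T}|%:R <=
  #|[set v : {ffun 'I_k -> T} | (k./2 < #|[set l | v l \in H]|)%N]|%:R.
Proof.
move=> k_odd p0 p1 cardH.
rewrite -[X in _ <= X%:R]sum1_card natr_sum.
rewrite (partition_big (fun v : {ffun 'I_k -> T} => [set l | v l \in H])
  (fun J : {set 'I_k} => (k./2 < #|J|)%N)) /=; last by move=> v; rewrite inE.
rewrite (eq_bigr (fun J : {set 'I_k} =>
   (p ^+ #|J| * (1 - p) ^+ (k - #|J|)) * #|{ffun 'I_k -> T}|%:R)); last first.
  move=> J Jk.
  rewrite -natr_sum sum1dep_card (_ : #|_| =
    #|[set v : {ffun 'I_k -> T} | [set l | v l \in H] == J]|); last first.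
    by apply: eq_card => v; rewrite !inE; case: eqP => [->|]; rewrite ?Jk ?andbF.
  rewrite card_pattern card_ffun card_ord natrM !natrX.
  rewrite natrB ?max_card // cardH.
  have -> : #|T|%:R - p * #|T|%:R = (1 - p) * #|T|%:R :> R by ring.
  have Jle : (#|J| <= k)%N by have := max_card (mem J); rewrite card_ord.
  have -> : #|T|%:R ^+ k = #|T|%:R ^+ #|J| * #|T|%:R ^+ (k - #|J|) :> R.
    by rewrite -exprD subnKC.
  by rewrite !exprMn; ring.
by rewrite -mulr_suml ler_wpM2r ?ler0n // binomial_tail.
Qed.

(** Were the median below [a], so would be the first [(size r)./2.+1] sorted entries, leaving too
    few that reach [a]. *)
Lemma median_ge (R : realType) (r : seq R) (a : R) :
  ((size r)./2 < count (fun x => a <= x)%R r)%N -> a <= median r.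
Proof.
move=> cnt; rewrite leNgt; apply/negP => lt_a.
have szS : size (sort <=%R r) = size r by rewrite size_sort.
have sz : ((size r)./2 < size r)%N by apply: (leq_trans cnt); exact: count_size.
move: cnt; rewrite -(count_sort <=%R) -(cat_take_drop (size r)./2.+1 (sort <=%R r)).
rewrite count_cat (_ : count _ (take _ _) = 0%N) ?add0n; last first.
  apply/eqP; rewrite -leqn0 leqNgt -has_count; apply/hasPn => x.
  move=> /(nthP 0)[j]; rewrite size_take szS.
  have -> : (if ((size r)./2.+1 < size r)%N then (size r)./2.+1 else size r) =
     (size r)./2.+1 by case: ifP; lia.
  move=> jle; rewrite nth_take // => <-; rewrite -ltNge.
  apply: le_lt_trans lt_a.
  have srt : sorted <=%R (sort <=%R r) by exact: (sort_sorted (@le_total _ R)).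
  apply: (sorted_leq_nth le_trans le_refl 0 srt); rewrite ?inE ?szS //.
  exact: (leq_trans jle sz).
move=> cnt; have := leq_trans cnt (count_size _ _).
rewrite size_drop szS; lia.
Qed.

(** * Reduction of probabilities to finite counting *)

Lemma uniform_rv_measurable (d : measure_display) (T : measurableType d)
    (R : realType) (P : probability T R) (W : finType) (V : T -> W) (B : set W) :
  uniform_rv P V -> measurable (V @^-1` B)%classic.
Proof.
by move=> [mV _]; apply: mV; exists B => //=; rewrite setTI.
Qed.

Lemma uniform_rv_prob (d : measure_display) (T : measurableType d)
    (R : realType) (P : probability T R) (W : finType) (V : T -> W) (A : {set W}) :
  uniform_rv P V ->
  P (V @^-1` [set v | v \in A])%classic = (#|A|%:R / #|W|%:R)%:E.
Proof.
move=> uV; have [_ uVv] := uV.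
have -> : (V @^-1` [set v | v \in A] =
           \bigcup_(v in [set` enum A]) V @^-1` [set v])%classic.
  apply/seteqP; split => w /=.
    by move=> wA; exists (V w) => //=; rewrite mem_enum.
  by move=> [v /= + ->]; rewrite mem_enum.
rewrite measure_fin_bigcup //; last 2 first.
  by move=> v u _ _ [w [/= -> ->]].
  by move=> v _; exact: uniform_rv_measurable uV.
rewrite -fsbig_seq ?enum_uniq // (eq_bigr (fun=> (#|W|%:R^-1 : R)%:E)) => [|v _].
  by rewrite sumEFin big_enum /= sumr_const -[X in X%:E = _]mulr_natl.
exact: uVv.
Qed.

(** Markov's inequality at level [t]. *)
Lemma uniform_rv_expectation_ge (d : measure_display) (T : measurableType d)
    (R : realType) (P : probability T R) (W : finType) (V : T -> W)
    (phi : W -> R) (A : {set W}) (t : R) :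
  uniform_rv P V -> 0 < t -> (forall v, v \in A -> t <= `|phi v|) ->
  ((t * (#|A|%:R / #|W|%:R))%:E <= 'E_P[fun w => `|phi (V w)|%R])%E.
Proof.
move=> uV t0 At; rewrite expectation.unlock.
have mphi : measurable_fun [set: T]%classic ((fun w => (phi (V w))%:E) : T -> \bar R).
  move=> _ Y mY; rewrite setTI.
  exact: (@uniform_rv_measurable _ _ _ P _ V (fun v => Y (phi v)%:E)).
apply: le_trans (le_integral_abse P measurableT mphi t0).
rewrite EFinM lee_pmul2l ?lte_fin //.
rewrite -(uniform_rv_prob _ _ _ _ _ _ _ uV) setTI.
apply: le_measure; rewrite ?inE.
- exact: uniform_rv_measurable uV.
- exact: (@uniform_rv_measurable _ _ _ P _ V (fun v => (t%:E <= `|(phi v)%:E|)%E)).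
- by move=> w /= /At; rewrite lee_fin.
Qed.

(** Turns the whole experiment into one uniform variable on a finite set, so that events become
    cardinalities. *)
Lemma uniform_rv_joint (d : measure_display) (T : measurableType d)
    (R : realType) (P : probability T R) (n B1 b k : nat)
    (h : 'I_k -> T -> bucket_hash n B1 b) (s : 'I_k -> T -> sign_hash n B1) :
  independent_random_hashes P h s ->
  uniform_rv P (fun w => [ffun l => (h l w, s l w)] :
    {ffun 'I_k -> bucket_hash n B1 b * sign_hash n B1}).
Proof.
move=> [uh us ind].
(* The full index set: the product rule is applied once, to all 2k events. *)
pose J0 : {set 'I_k + 'I_k} := [set x | true]%SET.
pose E (v : {ffun 'I_k -> bucket_hash n B1 b * sign_hash n B1}) (x : 'I_k + 'I_k) :=
  match x with inl l => h l @^-1` [set (v l).1]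
             | inr l => s l @^-1` [set (v l).2] end%classic.
have VE v : ((fun w => [ffun l => (h l w, s l w)] :
    {ffun 'I_k -> bucket_hash n B1 b * sign_hash n B1}) @^-1` [set v] =
    \bigcap_(x in [set x | x \in J0]) E v x)%classic.
  apply/seteqP; split => w /=.
    by move=> <- [l|l] _ /=; rewrite ffunE.
  move=> Ew; apply/ffunP => l; rewrite ffunE [RHS]surjective_pairing.
  by congr pair; [have := Ew (inl l)|have := Ew (inr l)]; apply; rewrite /= inE.
have mE v x : measurable (E v x).
  by case: x => l; [exact: uniform_rv_measurable (uh l)|exact: uniform_rv_measurable (us l)].
have mV v : measurable ((fun w => [ffun l => (h l w, s l w)] :
    {ffun 'I_k -> bucket_hash n B1 b * sign_hash n B1}) @^-1` [set v])%classic.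
  by rewrite VE; apply: fin_bigcap_measurable => //; exact: finite_finset.
split.
  move=> _ [B _ <-]; rewrite setTI.
  rewrite (_ : _ @^-1` B = \bigcup_(v in B)
    ((fun w => [ffun l => (h l w, s l w)]) @^-1` [set v]))%classic; last first.
    by apply/seteqP; split=> w /=; [move=> Bw; eexists; [exact: Bw|]|move=> [v Bv /= ->]].
  by apply: fin_bigcup_measurable => // v _; exact: mV.
move=> v; rewrite VE ind; last first.
  by move=> [l|l] _ /=; [exists [set (v l).1]%classic|exists [set (v l).2]%classic] => //; rewrite setTI.
rewrite (eq_bigl xpredT) => [|x]; last by rewrite inE.
rewrite big_sumType /=.
under eq_bigr => l _ do rewrite (proj2 (uh l)).
under [X in (_ * X)%E]eq_bigr => l _ do rewrite (proj2 (us l)).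
rewrite !prodEFin -EFinM !prodr_const [#|{ffun 'I_k -> _}|]card_ffun card_prod card_ord.
by rewrite natrX natrM -exprVn invfM exprMn.
Qed.

(** * The error of a single row *)

Definition row_error (R : realType) (n B1 b : nat) (i : item n B1)
    (x : bucket_hash n B1 b * sign_hash n B1) : R :=
  row_estimate R x.1 x.2 i - freq R i.

(** Weight 0 at [i] and outside its bucket makes the error a signed sum over all items, as in
    [small_ball]. *)
Definition collision_freq (R : realType) (n B1 b : nat) (g : bucket_hash n B1 b)
    (i j : item n B1) : R := if (j != i) && (g j == g i) then freq R j else 0.

(** The term of [i] carries the square of a sign and cancels [freq R i]. *)
Lemma row_errorE (R : realType) (n B1 b : nat) (i : item n B1)
    (g : bucket_hash n B1 b) (s : sign_hash n B1) :
  row_error R n B1 b i (g, s) =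
  (-1) ^+ s i * \sum_j (-1) ^+ s j * collision_freq R n B1 b g i j.
Proof.
rewrite /row_error /row_estimate /= (bigD1 i) //= [in RHS](bigD1 i) //=.
rewrite /collision_freq eqxx /= eqxx mul1r mulr0 add0r mulrDr mulrA -expr2 sqrr_sign mul1r.
rewrite addrC addKr; congr (_ * _); apply: eq_bigr => j ->.
by case: (g j == g i); rewrite /= ?mul1r // !mul0r mulr0.
Qed.

Lemma norm_row_error (R : realType) (n B1 b : nat) (i : item n B1)
    (g : bucket_hash n B1 b) (s : sign_hash n B1) :
  `|row_error R n B1 b i (g, s)| =
  `|\sum_j (-1) ^+ s j * collision_freq R n B1 b g i j|.
Proof. by rewrite row_errorE normrM normr_sign mul1r. Qed.

Definition flip_row (n B1 b : nat) (i : item n B1)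
    (x : bucket_hash n B1 b * sign_hash n B1) :
    bucket_hash n B1 b * sign_hash n B1 := (x.1, flip _ i x.2).

Lemma flip_rowK (n B1 b : nat) (i : item n B1) : involutive (flip_row n B1 b i).
Proof. by move=> [g s]; rewrite /flip_row /= flipK. Qed.

(** Only the outer sign changes, since [i] has weight 0 in the sum. *)
Lemma row_error_flip (R : realType) (n B1 b : nat) (i : item n B1)
    (x : bucket_hash n B1 b * sign_hash n B1) :
  row_error R n B1 b i (flip_row n B1 b i x) = - row_error R n B1 b i x.
Proof.
case: x => g s; rewrite !row_errorE /= ffunE eqxx signrN mulNr; congr (- (_ * _)).
apply: eq_bigr => j _; rewrite ffunE; case: eqP => // ->.
by rewrite /collision_freq eqxx !mulr0.
Qed.

(** By the flip, errors at least t and errors at most -t are equally many. *)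
Lemma card_row_error_ge (R : realType) (n B1 b : nat) (i : item n B1) (t : R) :
  0 < t ->
  (2 * #|[set x | (t <= row_error R n B1 b i x)%R]| +
   #|[set x | (`|row_error R n B1 b i x| < t)%R]| =
   #|{: bucket_hash n B1 b * sign_hash n B1}|)%N.
Proof.
move=> t0; rewrite mul2n -addnn -!sum1_card.
rewrite big_mkcond [X in (_ + X)%N = _]big_mkcond /=.
rewrite [X in (_ + X + _)%N](reindex_inj (inv_inj (flip_rowK n B1 b i))) /=.
rewrite -!big_split /=; apply: eq_bigr => x _; rewrite !inE row_error_flip.
rewrite ltr_norml; move: (row_error _ _ _ _ _ _) => e.
by do 3 (case: ifP => ?); rewrite //; exfalso; lra.
Qed.

Definition light_items (n B1 m : nat) : {set item n B1} :=
  [set j : item n B1 | (val (val j) <= m)%N].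

Lemma card_light_items (n B1 B2 : nat) : (B1 + B2 <= n)%N ->
  (B2 <= #|light_items n B1 (B1 + B2)|)%N.
Proof.
move=> le_n.
have lt_n (x : 'I_B2) : (B1 + x.+1 < n.+1)%N by case: x => x /=; lia.
have lt_B (x : 'I_B2) : (B1 < Ordinal (lt_n x))%N by rewrite /=; lia.
pose f x : item n B1 := exist _ (Ordinal (lt_n x)) (lt_B x).
have f_inj : injective f.
  by move=> x y /(congr1 (fun j => nat_of_ord (val j))) /= h; apply: val_inj => /=; lia.
rewrite -[X in (X <= _)%N]card_ord -(card_imset _ f_inj); apply: subset_leq_card.
by apply/fintype.subsetP => _ /imsetP[x _ ->]; rewrite inE /=; case: x => x /=; lia.
Qed.

(** Nonnegativity of the variance. *)
Lemma sqr_mean_le (R : realType) (T : finType) (a : T -> R) : (0 < #|T|)%N ->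
  #|T|%:R * ((\sum_x a x) / #|T|%:R) ^+ 2 <= \sum_x a x ^+ 2.
Proof.
move=> T0; set q := _ / _.
have NT : #|T|%:R != 0 :> R by rewrite pnatr_eq0 -lt0n.
have sum_a : \sum_x a x = #|T|%:R * q by rewrite mulrC divfK.
have : 0 <= \sum_x (a x - q) ^+ 2 by apply: sumr_ge0 => x _; exact: sqr_ge0.
under eq_bigr do rewrite sqrrB.
rewrite big_split sumrB /= sumrMnl -mulr_suml sum_a sumr_const.
rewrite -[q ^+ 2 *+ _]mulr_natl.
lra.
Qed.

(** The squared mean over buckets is at most the mean square; [small_ball] bounds each square by an
    inverse bucket size, and [sum_inv_bucket] averages these to at most b / |A|. *)
Lemma row_error_small (R : realType) (n B1 b : nat) (i : item n B1) (t : R)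
    (A : {set item n B1}) : 0 <= t -> (0 < b)%N -> i \in A ->
  (forall j, j \in A -> j != i -> t <= freq R j) ->
  #|A|%:R * (#|[set x | (`|row_error R n B1 b i x| < t)%R]|%:R /
             #|{: bucket_hash n B1 b * sign_hash n B1}|%:R) ^+ 2 <= b%:R :> R.
Proof.
move=> t0 b0 iA At.
pose S (g : bucket_hash n B1 b) := [set s : sign_hash n B1 |
  `|\sum_j (-1) ^+ s j * collision_freq R n B1 b g i j| < t].
(* The conditional probability of a small error given the buckets [g]. *)
pose a g : R := #|S g|%:R / (2 ^ #|item n B1|)%:R.
have NB : (0 < #|bucket_hash n B1 b|)%N by rewrite card_ffun expn_gt0 card_ord b0.
have -> : #|[set x | (`|row_error R n B1 b i x| < t)%R]|%:R =
    \sum_g #|S g|%:R :> R.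
  rewrite -natr_sum -sum1_card; congr _%:R.
  rewrite (partition_big (fun x : bucket_hash n B1 b * sign_hash n B1 => x.1) predT) //=.
  apply: eq_bigr => g _; rewrite -sum1_card.
  rewrite (reindex_onto (fun s => (g, s)) snd) /=; last first.
    by case=> g' s /= /andP[_ /eqP ->].
  by apply: eq_bigl => s; rewrite !inE /= norm_row_error !eqxx !andbT.
rewrite card_prod [#|sign_hash n B1|]card_ffun card_bool.
have -> : (\sum_g #|S g|%:R) / (#|bucket_hash n B1 b| * 2 ^ #|item n B1|)%:R =
    (\sum_g a g) / #|bucket_hash n B1 b|%:R.
  by rewrite -mulr_suml natrM invfM mulrA mulrAC.
have a_le g : a g ^+ 2 <= #|[set j in A | g j == g i]|%:R^-1.
  (* Removing [i] from its bucket leaves [#|M|] weights at least [t]; [i] accounts for the successor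
     in [small_ball]. *)
  pose M := [set j in A | g j == g i] :\ i.
  have MS : #|[set j in A | g j == g i]| = #|M|.+1.
    by rewrite (cardsD1 i) inE iA eqxx.
  rewrite MS -[leRHS]mul1r ler_pdivlMr ?ltr0n // mulrC.
  apply: small_ball => // j; rewrite !inE => /and3P[ji jA gj].
  by rewrite /collision_freq ji gj /=; exact: At.
have NB0 : 0 < #|bucket_hash n B1 b|%:R :> R by rewrite ltr0n.
rewrite -(ler_pM2r NB0) -mulrA [X in _ * X]mulrC.
apply: (@le_trans _ _ (#|A|%:R * \sum_g a g ^+ 2)).
  by rewrite ler_wpM2l ?ler0n // sqr_mean_le.
apply: (@le_trans _ _ (#|A|%:R * \sum_(g : bucket_hash n B1 b) (#|[set j in A | g j == g i]|%:R^-1))).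
  by rewrite ler_wpM2l ?ler0n //; apply: ler_sum.
by have := sum_inv_bucket R (item n B1) 'I_b A i iA; rewrite card_ord.
Qed.

(** * From rows to the median estimate *)

(** The condition is one-sided: large errors of opposite signs could leave the median close to the
    true frequency. *)
Lemma cs_estimate_error_ge (R : realType) (n B1 b k : nat) (i : item n B1) (t : R)
    (v : {ffun 'I_k -> bucket_hash n B1 b * sign_hash n B1}) :
  (k./2 < #|[set l | v l \in [set x | (t <= row_error R n B1 b i x)%R]]|)%N ->
  t <= `|cs_estimate R (fun l => (v l).1) (fun l => (v l).2) i - freq R i|.
Proof.
move=> maj; apply: le_trans (ler_norm _); rewrite lerBrDr.
apply: median_ge; rewrite size_map size_enum_ord count_map.
apply: (leq_trans maj); rewrite cardE size_filter -/(enum 'I_k) eq_leq //.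
rewrite [enum 'I_k]enumT; apply: eq_count => l.
by rewrite !inE /row_error /= lerBrDr.
Qed.

Theorem theorem5p5 (R : realType) :
  exists c : R, 0 < c /\
    forall (n B1 B2 k : nat),
      (0 < B2)%N ->
      (B1 + B2 <= n)%N -> (2 * B1 <= B1 + B2)%N ->
      (3 <= k)%N -> odd k -> (k %| B2)%N ->
    forall (d : measure_display) (T : measurableType d) (P : probability T R)
      (h : 'I_k -> T -> bucket_hash n B1 (B2 %/ k))
      (s : 'I_k -> T -> sign_hash n B1),
      independent_random_hashes P h s ->
    forall i : item n B1,
      ((c / B2%:R)%:E <=
       'E_P[fun w : T =>
              (`| cs_estimate R (fun l => h l w) (fun l => s l w) i
                 - freq R i |)%R])%E.
Proof.
(* Error at least 1/(2 B2) with probability at least 1/24. *)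
exists (1 / 48); split; first by lra.
move=> n B1 B2 k B2_gt0 le_n le_B k3 k_odd kB2 d T P h s hs i.
set b := (B2 %/ k)%N in h hs *.
pose Row : finType := (bucket_hash n B1 b * sign_hash n B1)%type.
have B2R : 0 < B2%:R :> R by rewrite ltr0n.
have bk : (b * k = B2)%N by rewrite divnK.
have b0 : (0 < b)%N by rewrite lt0n; apply/eqP => b0; rewrite -bk b0 in B2_gt0.
pose t : R := (2 * B2%:R)^-1.
have t0 : 0 < t by rewrite invr_gt0 mulr_gt0.
(* [i] is adjoined because it may lie beyond B1 + B2. *)
pose A := i |: light_items n B1 (B1 + B2).
have cardA : (B2 <= #|A|)%N.
  by apply: (leq_trans (card_light_items n B1 B2 le_n)); rewrite subset_leq_card // finset.subsetUr.
have At j : j \in A -> j != i -> t <= freq R j.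
  rewrite !inE => /predU1P[->|jB _]; first by rewrite eqxx.
  rewrite /freq /t lef_pV2 ?posrE ?mulr_gt0 // ?ltr0n; last by case: (j) => j' /=; lia.
  (* From B1 <= B2 follows j <= B1 + B2 <= 2 B2. *)
  by rewrite -natrM ler_nat; apply: (leq_trans jB); lia.
pose H := [set x : Row | t <= row_error R n B1 b i x].
pose N : R := #|Row|%:R.
pose Z := #|[set x : Row | `|row_error R n B1 b i x| < t]|.
pose q : R := Z%:R / N.
have N0 : 0 < N.
  rewrite ltr0n card_prod muln_gt0 !card_ffun !expn_gt0 card_bool card_ord b0 //.
have q_small : k%:R * q ^+ 2 <= 1.
  have := row_error_small R n B1 b i t A (ltW t0) b0 _ At.
  rewrite !inE eqxx => /(_ isT) qA.
  have : B2%:R * q ^+ 2 <= b%:R.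
    by apply: le_trans qA; rewrite ler_wpM2r ?sqr_ge0 // ler_nat.
  by rewrite -bk natrM -mulrA -[X in _ <= X]mulr1 ler_pM2l // ltr0n.
have kR : 3 <= k%:R :> R by rewrite (ler_nat _ 3).
have q0 : 0 <= q by rewrite divr_ge0 ?ler0n.
have q1 : q < 1.
  rewrite ltNge; apply/negP => q1.
  have : 1 <= q ^+ 2 by rewrite exprn_ege1.
  nra.
pose p : R := (1 - q) / 2.
have cardH : #|H|%:R = p * N.
  have := card_row_error_ge R n B1 b i t t0.
  rewrite -/H -/Z => /(congr1 (fun x => x%:R : R)).
  rewrite natrD natrM -/N.
  have -> : Z%:R = q * N by rewrite /q divfK // gt_eqF.
  rewrite /p => e; lra.
have p_gt0 : 0 < p by rewrite /p; lra.
have p_lt1 : p < 1 by rewrite /p; lra.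
have := majority_count R Row k H p k_odd p_gt0 p_lt1 cardH.
set G := [set v | _] => tail.
(* The factor 1/4 of the majority tail times the 1/6 of [bernoulli_sixth]. *)
have G_ge : 1 / 24 <= #|G|%:R / #|{ffun 'I_k -> Row}|%:R :> R.
  have NV : 0 < #|{ffun 'I_k -> Row}|%:R :> R.
    by rewrite card_ffun natrX exprn_gt0.
  rewrite ler_pdivlMr //; apply: le_trans tail; rewrite ler_wpM2r ?(ltW NV) //.
  have -> : 4 * (p * (1 - p)) = 1 - q ^+ 2 by rewrite /p; field.
  have le1 : 1 - k%:R^-1 <= 1 - q ^+ 2.
    rewrite lerD2l lerN2 -[leRHS]mul1r ler_pdivlMr ?ltr0n; last by lia.
    by rewrite mulrC.
  have u1 : 0 <= 1 - k%:R^-1 :> R.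
    by rewrite subr_ge0 invf_le1 ?(le_trans _ kR) ?ltr0n //; [lra|lia].
  have := bernoulli_sixth R k k3 k_odd.
  have : (1 - k%:R^-1) ^+ k <= (1 - q ^+ 2) ^+ k.
    by apply: lerXn2r => //; rewrite ?nnegrE // (le_trans u1).
  lra.
have := uniform_rv_expectation_ge _ _ _ _ _ _
  (fun v : {ffun 'I_k -> Row} =>
     cs_estimate R (fun l => (v l).1) (fun l => (v l).2) i - freq R i)
  G t (uniform_rv_joint _ _ _ _ _ _ _ _ _ _ hs) t0.
have GG v : v \in G ->
  t <= `|cs_estimate R (fun l => (v l).1) (fun l => (v l).2) i - freq R i|.
  by rewrite inE; exact: cs_estimate_error_ge.
move=> /(_ GG).
have -> : (fun w => `|cs_estimate R
    (fun l => ([ffun l => (h l w, s l w)] l).1)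
    (fun l => ([ffun l => (h l w, s l w)] l).2) i - freq R i|) =
  (fun w => `|cs_estimate R (fun l => h l w) (fun l => s l w) i - freq R i|).
  apply/funext => w; congr (`|_ - _|); congr cs_estimate; apply/funext => l; by rewrite ffunE.
apply: le_trans; rewrite lee_fin.
have -> : 1 / 48 / B2%:R = t * (1 / 24) by rewrite /t; field; rewrite gt_eqF.
by rewrite ler_pM2l.
Qed.
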